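(* Let $s,t\ge 1$ be integers. Then $\chi_p(P_{3t}\Diamond_3 C_{4s})=3$ if $t=1$, and $\chi_p(P_{3t}\Diamond_3 C_{4s})=4$ if $t\ge 2$.
   Context: A packing $k$-coloring of a graph $H$ is a map $c:V(H)\to\{1,\ldots,k\}$ such that any two distinct vertices $u,v$ with $c(u)=c(v)=i$ satisfy $d_H(u,v)\ge i+1$. The packing chromatic number $\chi_p(H)$ is the least such $k$. $P_m$ denotes the path $v_1\cdots v_m$ and $C_n$ the cycle on $n$ vertices. Path-aligned product: for positive integers $\ell\mid m$ and a connected vertex-transitive graph $G$ containing $P_\ell$ as a subgraph, $P_m\Diamond_\ell G$ is formed from the path $P_m=v_1\cdots v_m$ and $m/\ell$ pairwise disjoint copies of $G$, where for each $1\le i\le m/\ell$ the consecutive path vertices $v_{(i-1)\ell+1},\ldots,v_{i\ell}$ are identified, in order, with the vertices of a path $P_\ell$ (i.e. $\ell$ consecutive cycle vertices when $G$ is a cycle) in the $i$-th copy of $G$. *)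

(* Defs.v *)
From HB Require Import structures.
From mathcomp Require Import all_boot.

Set Implicit Arguments.
Unset Strict Implicit.
Unset Printing Implicit Defensive.

Record sgraph := SGraph {
  vert :> finType;
  adj : rel vert;
  adj_sym : symmetric adj;
  adj_irr : irreflexive adj }.

Arguments adj {s}.

Section PackingColoring.

Variable H : sgraph.

Definition has_walk (k : nat) (u v : H) : bool :=
  [exists w : k.-tuple H, path adj u w && (last u w == v)].

Lemma connect_has_walk (u v : H) :
  connect adj u v -> exists k, has_walk k u v.
Proof.
case/connectP=> w uw ->; exists (size w).
by apply/existsP; exists (in_tuple w); rewrite /= uw eqxx.
Qed.

(* [None] is the infinite distance between distinct components. *)
Definition dist (u v : H) : option nat :=
  if @idP (connect adj u v) is ReflectT uv
  then Some (ex_minn (connect_has_walk uv)) else None.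

Definition dist_ge (k : nat) (u v : H) : bool :=
  if dist u v is Some d then k <= d else true.

(* Colors are 1, ..., k, whereas 'I_k is {0, ..., k-1}. *)
Definition color (k : nat) (c : {ffun H -> 'I_k}) (v : H) : nat := (c v).+1.

Definition packing_coloring (k : nat) (c : {ffun H -> 'I_k}) : bool :=
  [forall u, forall v,
     (u != v) ==> (color c u == color c v) ==> dist_ge (color c u).+1 u v].

Definition packing_colorable (k : nat) : bool :=
  [exists c : {ffun H -> 'I_k}, packing_coloring c].

Lemma ex_packing_colorable : exists k, packing_colorable k.
Proof.
exists #|H|; apply/existsP; exists [ffun v => enum_rank v].
apply/forallP=> u; apply/forallP=> v; apply/implyP=> uv; apply/implyP.
by rewrite /color !ffunE eqSS => /eqP/val_inj/enum_rank_inj/eqP; rewrite (negPf uv).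
Qed.

Definition packing_chromatic_number : nat := ex_minn ex_packing_colorable.

End PackingColoring.

Section PathGraph.

Variable m : nat.

Definition path_adj : rel 'I_m :=
  fun i j => (j == i.+1 :> nat) || (i == j.+1 :> nat).

Lemma path_adj_sym : symmetric path_adj.
Proof. by move=> i j; rewrite /path_adj orbC. Qed.

Lemma path_adj_irr : irreflexive path_adj.
Proof. by move=> i; rewrite /path_adj orbb ltn_eqF. Qed.

Definition path_graph : sgraph := SGraph path_adj_sym path_adj_irr.

End PathGraph.

Section CycleGraph.

Variable n : nat.

(* The usual cycle for n >= 3. *)
Definition cycle_adj : rel 'I_n :=
  fun i j => (i != j) && ((j == i.+1 %% n :> nat) || (i == j.+1 %% n :> nat)).

Lemma cycle_adj_sym : symmetric cycle_adj.
Proof. by move=> i j; rewrite /cycle_adj eq_sym orbC. Qed.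

Lemma cycle_adj_irr : irreflexive cycle_adj.
Proof. by move=> i; rewrite /cycle_adj eqxx. Qed.

Definition cycle_graph : sgraph := SGraph cycle_adj_sym cycle_adj_irr.

End CycleGraph.

(* A copy of P_l as a (not necessarily induced) subgraph of G. *)
Record path_in (l : nat) (G : sgraph) := PathIn {
  path_vertex :> path_graph l -> G;
  path_vertex_inj : injective path_vertex;
  path_vertex_adj : forall i j : path_graph l,
    adj i j -> adj (path_vertex i) (path_vertex j) }.

Section PathAlignedProduct.

(* p i is the path P_l chosen in the i-th of the m / l copies of G. *)
Variables (m l : nat) (G : sgraph) (p : 'I_(m %/ l) -> path_in l G).

(* Vertex (i, x) is the vertex x of the i-th copy of G. When l divides m, each
   vertex of P_m is identified with exactly one of these, so that the pairs
   exhaust the vertices of the product. *)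
Definition aligned_vertex : finType := ('I_(m %/ l) * G)%type.

Definition aligned_at (a : path_graph m) (x : aligned_vertex) : bool :=
  [exists j : 'I_l, (a == x.1 * l + j :> nat) && (x.2 == p x.1 j)].

Definition aligned_adj : rel aligned_vertex := fun x y =>
  (x.1 == y.1) && adj x.2 y.2
  || [exists a, exists b, [&& adj a b, aligned_at a x & aligned_at b y]].

Lemma aligned_adj_sym : symmetric aligned_adj.
Proof.
move=> x y; rewrite /aligned_adj eq_sym adj_sym; congr (_ || _).
by apply/existsP/existsP=> -[a /existsP[b /and3P[ab ax bY]]];
  exists b; apply/existsP; exists a; rewrite adj_sym ab ax bY.
Qed.

Lemma aligned_adj_irr : irreflexive aligned_adj.
Proof.
move=> x; rewrite /aligned_adj adj_irr andbF /=; apply/existsP=> -[a].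
case/existsP=> b /and3P[ab /existsP[i /andP[/eqP ai /eqP xi]]].
case/existsP=> j /andP[/eqP bj /eqP xj].
have ij : adj (i : path_graph l) j.
  by move: ab; rewrite /= /path_adj ai bj -!addnS !eqn_add2l.
by have := path_vertex_adj (p x.1) ij; rewrite -xi -xj adj_irr.
Qed.

Definition path_aligned_product : sgraph :=
  SGraph aligned_adj_sym aligned_adj_irr.

End PathAlignedProduct.

(* Main.v *)
Require Import Defs.
From HB Require Import structures.
From mathcomp Require Import all_boot.
From mathcomp Require Import zify.

(** Lower bounds. Two colors cannot color a path on four vertices. With three
    colors, let [cd] be the edge joining two consecutive copies: both ends have
    degree 3, hence neither is colored 1 (its three neighbors would share the
    colors 2 and 3), so they are colored 2 and 3. On the path leaving
    from the end colored 2, the next vertex must be colored 1 and the one after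
    it sees all three colors.

    Upper bound. Number each cycle so that the aligned path occupies positions
    0, 1, 2. Color the copies periodically, with period 4, repeating around the
    cycle the words 3121, 1213, 2131, 1312, and recolor by 4 position 1 of the
    copies of the second and fourth kind. The first kind alone colors the cycle
    with three colors. *)

Set Implicit Arguments.
Unset Strict Implicit.
Unset Printing Implicit Defensive.

Section PackingColorings.

Variable H : sgraph.
Implicit Types (u v w x y : H) (f : H -> nat).

Lemma dist_geP k u v :
  reflect (forall j, j < k -> ~~ has_walk j u v) (dist_ge k u v).
Proof.
rewrite /dist_ge /dist; case: {-}_ / idP => [uv | nuv].
  case: ex_minnP => d dw dmin; apply: (iffP idP) => [kd j jk | noW].
    by apply/negP => /dmin; lia.
  by rewrite leqNgt; apply/negP => /noW; rewrite dw.
constructor=> j _; apply/negP => /existsP[w /andP[uw /eqP wv]].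
by apply: nuv; apply/connectP; exists w.
Qed.

Definition is_packing f :=
  forall u v j, u != v -> f u = f v -> j <= f u -> ~~ has_walk j u v.

Lemma packing_colorableP k :
  packing_colorable H k <->
  exists2 f, (forall v, 0 < f v <= k) & is_packing f.
Proof.
split=> [/existsP[c cP] | [f fk fP]].
  exists (color c) => [v | u v j uv cuv]; first by rewrite /color /= ltn_ord.
  move/forallP/(_ u)/forallP/(_ v): cP; rewrite uv cuv eqxx /=.
  by move/dist_geP; apply.
case: k fk => [fk | k fk].
  have H0 v : False by have := fk v; lia.
  apply/existsP; exists [ffun v => False_rect _ (H0 v)].
  by apply/forallP => v; case: (H0 v).
apply/existsP; exists [ffun v => inord (f v).-1].
have cE v : color [ffun v => inord (f v).-1 : 'I_k.+1] v = f v.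
  by rewrite /color ffunE inordK; have := fk v; lia.
apply/forallP => u; apply/forallP => v; apply/implyP => uv; apply/implyP.
rewrite !cE => /eqP fuv; apply/dist_geP => j; rewrite ltnS => jf.
exact: fP.
Qed.

Lemma packing_chromatic_numberS k :
  packing_colorable H k.+1 -> ~ packing_colorable H k ->
  packing_chromatic_number H = k.+1.
Proof.
move=> colS ncol; rewrite /packing_chromatic_number.
case: ex_minnP => d dcol dmin; apply/eqP; rewrite eqn_leq dmin //=.
rewrite ltnNge; apply/negP => dk; apply: ncol; apply/packing_colorableP.
case/packing_colorableP: dcol => f fd fP; exists f => // v.
by have := fd v; lia.
Qed.

Lemma is_packing_neq f u (w : seq H) :
  is_packing f -> path adj u w -> u != last u w -> size w <= f u ->
  f u != f (last u w).
Proof.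
move=> fP uw uv le_w; apply/eqP => fuv.
have /negP[] := fP _ _ _ uv fuv le_w.
by apply/existsP; exists (in_tuple w); rewrite /= uw eqxx.
Qed.

Lemma adj_neq u v : adj u v -> u != v.
Proof. by apply: contraTneq => ->; rewrite adj_irr. Qed.

Lemma is_packing_neq1 f u v :
  is_packing f -> (forall x, 0 < f x) -> adj u v -> f u != f v.
Proof.
move=> fP f0 uv.
by apply: (@is_packing_neq f u [:: v]); rewrite //= ?uv ?adj_neq.
Qed.

Lemma is_packing_neq2 f u v w :
  is_packing f -> (forall x, 0 < f x) -> adj u v -> adj v w -> u != w ->
  (f u != f w) || (f u == 1).
Proof.
move=> fP f0 uv vw uw; rewrite orbC -implyNb; apply/implyP => fu1.
apply: (@is_packing_neq f u [:: v; w]) => //=; first by rewrite uv vw.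
by have := f0 u; lia.
Qed.

Lemma is_packing_neq3 f u v w x :
  is_packing f -> (forall x, 0 < f x) ->
  adj u v -> adj v w -> adj w x -> u != x -> (f u != f x) || (f u <= 2).
Proof.
move=> fP f0 uv vw wx ux; rewrite orbC -implyNb; apply/implyP => fu1.
by apply: (@is_packing_neq f u [:: v; w; x]) => //=; [rewrite uv vw wx | lia].
Qed.

Lemma path4_not_packing_colorable2 u v w x :
  adj u v -> adj v w -> adj w x -> u != w -> v != x ->
  ~ packing_colorable H 2.
Proof.
move=> uv vw wx uw vx /packing_colorableP[f fk fP].
have f0 y : 0 < f y by case/andP: (fk y).
have := is_packing_neq1 fP f0 uv; have := is_packing_neq1 fP f0 vw.
have := is_packing_neq1 fP f0 wx.
have := is_packing_neq2 fP f0 uv vw uw; have := is_packing_neq2 fP f0 vw wx vx.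
have := fk u; have := fk v; have := fk w; have := fk x; lia.
Qed.

Lemma center_of_claw_neq1 f v x y z :
  is_packing f -> (forall u, 0 < f u <= 3) ->
  adj v x -> adj v y -> adj v z -> x != y -> x != z -> y != z -> f v != 1.
Proof.
move=> fP fk vx vy vz xy xz yz; apply/eqP => fv.
have f0 u : 0 < f u by case/andP: (fk u).
have xv : adj x v by rewrite adj_sym.
have yv : adj y v by rewrite adj_sym.
have := is_packing_neq1 fP f0 vx; have := is_packing_neq1 fP f0 vy.
have := is_packing_neq1 fP f0 vz.
have := is_packing_neq2 fP f0 xv vy xy; have := is_packing_neq2 fP f0 xv vz xz.
have := is_packing_neq2 fP f0 yv vz yz.
by move: fv (fk x) (fk y) (fk z); clear; lia.
Qed.

Lemma path4_not_packing32 f c d e g :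
  is_packing f -> (forall u, 0 < f u <= 3) ->
  adj c d -> adj d e -> adj e g -> c != e -> d != g -> c != g ->
  f c = 3 -> f d != 2.
Proof.
move=> fP fk cd de eg ce dg cg fc; apply/eqP => fd.
have f0 u : 0 < f u by case/andP: (fk u).
have := is_packing_neq1 fP f0 de; have := is_packing_neq1 fP f0 eg.
have := is_packing_neq2 fP f0 cd de ce; have := is_packing_neq2 fP f0 de eg dg.
have := is_packing_neq3 fP f0 cd de eg cg.
have := fk e; have := fk g; lia.
Qed.

Lemma two_claws_not_packing_colorable3 (a b c c' d e' e g : H) :
  adj a b -> adj b c -> adj c c' -> adj c d -> adj d e -> adj d e' -> adj e g ->
  uniq [:: a; b; c; d; e; g] -> c' != b -> c' != d -> e' != c -> e' != e ->
  ~ packing_colorable H 3.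
Proof.
move=> ab bc cc' cd de de' eg; rewrite /= !inE !negb_or.
case/and5P=> /and5P[nab nac nad _ _] /and4P[nbc nbd _ _].
move=> /and3P[ncd nce ncg] /andP[nde ndg] _.
move=> c'b c'd e'c e'e /packing_colorableP[f fk fP].
have [ba cb dc ed] : [/\ adj b a, adj c b, adj d c & adj e d].
  by split; rewrite adj_sym.
have fc : f c != 1 by apply: (center_of_claw_neq1 fP fk cc' cb cd).
have fd : f d != 1.
  by apply: (center_of_claw_neq1 fP fk de' dc de).
have f0 u : 0 < f u by case/andP: (fk u).
have fcd := is_packing_neq1 fP f0 cd.
have fc3 := path4_not_packing32 fP fk cd de eg nce ndg ncg.
have fd3 := path4_not_packing32 fP fk dc cb ba.
rewrite eq_sym nbd eq_sym nac eq_sym nad in fd3.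
by move: fc fd fcd fc3 (fd3 isT isT isT) (fk c) (fk d); clear; lia.
Qed.

End PackingColorings.

Ltac split_if_lia := repeat (case: ifP => ?); lia.

Definition cycle_step n a b :=
  [|| b == a.+1, a == b.+1, (a == 0) && (b == n.-1) | (b == 0) && (a == n.-1)].

Lemma succ_modn n i : i < n -> i.+1 %% n = if i.+1 == n then 0 else i.+1.
Proof.
by move=> ltin; case: eqP => [<- | /eqP ne]; rewrite ?modnn // modn_small; lia.
Qed.

Lemma cycle_adjE n (x y : cycle_graph n) : 2 < n -> adj x y = cycle_step n x y.
Proof.
have ltx := ltn_ord x; have lty := ltn_ord y; move=> n2.
rewrite /= /cycle_adj /cycle_step !succ_modn // -val_eqE /=.
by case: ifP => xn; case: ifP => yn; lia.
Qed.

Lemma cycle_other_neighbor n (x y : cycle_graph n) : 2 < n ->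
  exists2 z : cycle_graph n, adj x z & z != y.
Proof.
move=> n2; have ltx := ltn_ord x.
have lts : (if x.+1 == n then 0 else x.+1) < n by case: ifP; lia.
have ltp : (if x == 0 :> nat then n.-1 else x.-1) < n by case: ifP; lia.
pose zs : cycle_graph n := Ordinal lts; pose zp : cycle_graph n := Ordinal ltp.
have xs : adj x zs by rewrite cycle_adjE // /cycle_step /=; case: ifP; lia.
have xp : adj x zp by rewrite cycle_adjE // /cycle_step /=; case: ifP; lia.
have [zsy | zsy] := eqVneq zs y; last by exists zs.
exists zp => //; rewrite -zsy -val_eqE /=.
by clear zsy xs xp zs zp; split_if_lia.
Qed.

Section CyclePosition.

Variables (n : nat) (q : path_in 3 (cycle_graph n)).

Definition pathv (k : nat) : cycle_graph n := q (inord k : 'I_3).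

Lemma adj_pathv k : k < 2 -> adj (pathv k) (pathv k.+1).
Proof.
move=> k2; apply: path_vertex_adj.
by rewrite /= /path_adj !inordK ?eqxx //; lia.
Qed.

Lemma pathv_neq j k : j < 3 -> k < 3 -> j != k -> pathv j != pathv k.
Proof.
move=> j3 k3; apply: contraNneq => /path_vertex_inj/(congr1 val)/=.
by rewrite !inordK // => ->.
Qed.

Hypothesis n4 : 3 < n.

(* The distance from [pathv 0] to [x], traveling towards [pathv 1]. *)
Definition cpos (x : cycle_graph n) : nat :=
  let o := pathv 0 in
  if pathv 1 == o.+1 %% n :> nat
  then if o <= x then x - o else x + n - o
  else if x <= o then o - x else o + n - x.

Lemma cpos_lt x : cpos x < n.
Proof. by have := ltn_ord x; have := ltn_ord (pathv 0); rewrite /cpos; split_if_lia. Qed.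

Lemma cpos_inj : injective cpos.
Proof.
move=> x y; have := ltn_ord x; have := ltn_ord y; have := ltn_ord (pathv 0).
move=> ltp lty ltx cxy; apply: val_inj => /=; move: cxy; rewrite /cpos.
by case: (_ == _); split_if_lia.
Qed.

Lemma cpos_pathv k : k < 3 -> cpos (pathv k) = k.
Proof.
have := adj_pathv (isT : 0 < 2); have := adj_pathv (isT : 1 < 2).
rewrite !cycle_adjE /cycle_step; try lia.
have := pathv_neq (isT : 0 < 3) (isT : 2 < 3) isT; rewrite -val_eqE /=.
have l0 := ltn_ord (pathv 0); have l1 := ltn_ord (pathv 1).
have l2 := ltn_ord (pathv 2); rewrite /cpos succ_modn //.
by case: k => [|[|[|k]]] //; case: (_.+1 =P n) => ?; split_if_lia.
Qed.

Lemma cpos_adj x y : adj x y -> cycle_step n (cpos x) (cpos y).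
Proof.
rewrite cycle_adjE /cycle_step; last lia.
have := ltn_ord x; have := ltn_ord y; have := ltn_ord (pathv 0).
by rewrite /cycle_step /cpos; case: (_ == _ %% _); split_if_lia.
Qed.

End CyclePosition.

Definition cdist (n a b : nat) : nat :=
  minn (maxn a b - minn a b) (n - (maxn a b - minn a b)).

Definition color_pattern (i a : nat) : nat :=
  match i %% 4, a %% 4 with
  | 0, 0 => 3 | 0, 2 => 2 | 0, _ => 1
  | 1, 1 => if a == 1 then 4 else 2 | 1, 3 => 3 | 1, _ => 1
  | 2, 0 => 2 | 2, 2 => 3 | 2, _ => 1
  | _, 1 => if a == 1 then 4 else 3 | _, 3 => 2 | _, _ => 1
  end.

(* Lower bound for the distance between position [a] of copy [i] and position
   [b] of copy [j]. *)
Definition gdist (n i a j b : nat) : nat :=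
  if i == j then cdist n a b
  else if i < j then cdist n a 2 + 3 * (j - i) - 2 + cdist n 0 b
  else cdist n a 0 + 3 * (i - j) - 2 + cdist n 2 b.

Lemma cdistC n a b : cdist n a b = cdist n b a.
Proof. by rewrite /cdist (maxnC a) (minnC a). Qed.

Lemma gdistC n i a j b : gdist n i a j b = gdist n j b i a.
Proof.
rewrite /gdist eq_sym (cdistC n a b) (cdistC n a 2) (cdistC n a 0).
rewrite (cdistC n 0 b) (cdistC n 2 b).
by case: (ltngtP j i) => *; lia.
Qed.

Lemma cdist_ge_dvd n d a b :
  a < n -> b < n -> a != b -> d %| n -> a = b %[mod d] -> d <= cdist n a b.
Proof.
wlog ltab : a b / a < b => [IH | an bn _ dn ab].
  move=> an bn nab dn ab; have [/IH|/IH] : a < b \/ b < a by lia.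
    exact.
  by rewrite cdistC; apply; rewrite // eq_sym.
have dba : d %| b - a by rewrite -eqn_mod_dvd 1?ltnW // ab.
have dnab : d %| n - (b - a) by rewrite dvdn_sub.
rewrite /cdist (maxn_idPr (ltnW ltab)) (minn_idPl (ltnW ltab)).
by rewrite leq_min; apply/andP; split; apply: dvdn_leq => //;
  move: ltab bn; clear; lia.
Qed.

Lemma cdist0_ge s b : b < 4 * s ->
  match b %% 4 with
  | 0 => 0 | 1 => if b == 1 then 1 else 3 | 2 => 2 | _ => 1
  end <= cdist (4 * s) 0 b.
Proof.
have := divn_eq b 4; have := ltn_pmod b (isT : 0 < 4).
rewrite /cdist; case: (b %% 4) => [|[|[|[|?]]]] // _; move: (b %/ 4) => q *;
  split_if_lia.
Qed.

Lemma cdist2_ge s a : a < 4 * s ->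
  match a %% 4 with
  | 0 => 2 | 1 => if a == 1 then 1 else 3 | 2 => 0 | _ => 1
  end <= cdist (4 * s) a 2.
Proof.
have := divn_eq a 4; have := ltn_pmod a (isT : 0 < 4).
rewrite /cdist; case: (a %% 4) => [|[|[|[|?]]]] // _; move: (a %/ 4) => q *;
  split_if_lia.
Qed.

Lemma cdistxx n a : cdist n a a = 0.
Proof. by rewrite /cdist maxnn minnn subnn min0n. Qed.

Lemma cdist02 n : 3 < n -> cdist n 0 2 = 2.
Proof. by rewrite /cdist; lia. Qed.

Lemma cdist_step n c a b : a < n -> b < n -> c < n ->
  cycle_step n a b -> cdist n c b <= (cdist n c a).+1.
Proof. by rewrite /cdist /cycle_step; lia. Qed.

Lemma gdist_step n k c i a b : 3 < n -> a < n -> b < n -> c < n ->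
  cycle_step n a b -> gdist n k c i b <= (gdist n k c i a).+1.
Proof.
move=> n4 an bn cn ab.
have step z : z < n -> cdist n z b <= (cdist n z a).+1.
  by move=> zn; apply: cdist_step.
have := step c cn; have := step 0 (leq_trans (isT : 0 < 4) n4); have := step 2 (ltnW n4).
by rewrite /gdist; clear; split_if_lia.
Qed.

Lemma gdist_bridge n k c i : 3 < n ->
  gdist n k c i.+1 0 <= (gdist n k c i 2).+1 /\
  gdist n k c i 2 <= (gdist n k c i.+1 0).+1.
Proof.
move=> n4; have c02 := cdist02 n4; have c20 : cdist n 2 0 = 2 by rewrite cdistC.
rewrite /gdist !cdistxx c02 c20.
by split; split_if_lia.
Qed.

Lemma color_pattern_bounds i a : 0 < color_pattern i a <= 4.
Proof.
rewrite /color_pattern.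
by case: (i %% 4) => [|[|[|?]]]; case: (a %% 4) => [|[|[|[|?]]]] //; case: ifP.
Qed.

Lemma color_pattern0_bounds a : 0 < color_pattern 0 a <= 3.
Proof. by rewrite /color_pattern; case: (a %% 4) => [|[|[|?]]]. Qed.

Lemma color_pattern4 i a : color_pattern i a = 4 -> a = 1.
Proof.
rewrite /color_pattern.
by case: (i %% 4) => [|[|[|?]]]; case: (a %% 4) => [|[|[|[|?]]]] //; case: eqP.
Qed.

Lemma color_pattern_copy i a b :
  color_pattern i a = color_pattern i b ->
  a = b %[mod if color_pattern i a == 1 then 2 else 4].
Proof.
have mod2 c : c %% 2 = (c %% 4) %% 2 by rewrite modn_dvdm.
move=> cab; suff: (if color_pattern i a == 1 then (a %% 4) %% 2 == (b %% 4) %% 2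
                   else a %% 4 == b %% 4).
  by case: ifP => _ /eqP ab; rewrite // (mod2 a) (mod2 b) ab.
move: cab (ltn_pmod a (isT : 0 < 4)) (ltn_pmod b (isT : 0 < 4)).
rewrite /color_pattern; case: (a == 1); case: (b == 1); clear;
  case: (i %% 4) => [|[|[|?]]]; case: (a %% 4) => [|[|[|[|?]]]] //;
  case: (b %% 4) => [|[|[|[|?]]]] //.
Qed.

Lemma color_pattern_next s i a b : a < 4 * s -> b < 4 * s ->
  color_pattern i a = color_pattern i.+1 b ->
  color_pattern i a <= cdist (4 * s) a 2 + cdist (4 * s) 0 b.
Proof.
move=> /cdist2_ge cda /cdist0_ge cdb cab.
apply: leq_trans (leq_add cda cdb); move: cab {cda cdb}.
rewrite /color_pattern -[i.+1]addn1 -modnDml.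
have := ltn_pmod a (isT : 0 < 4); have := ltn_pmod b (isT : 0 < 4).
have := ltn_pmod i (isT : 0 < 4); case: (a == 1); case: (b == 1);
  case: (i %% 4) => [|[|[|[|?]]]] // _; case: (b %% 4) => [|[|[|[|?]]]] // _;
  case: (a %% 4) => [|[|[|[|?]]]] // _.
Qed.

Lemma gdist_color_pattern (s i a j b : nat) :
  a < 4 * s -> b < 4 * s -> (i != j) || (a != b) ->
  color_pattern i a = color_pattern j b ->
  color_pattern i a < gdist (4 * s) i a j b.
Proof.
wlog le_ij : i a j b / i <= j => [IH | a4 b4 nab cab].
  case: (leqP i j) => [/IH|/ltnW/IH IHji a4 b4 nab cab]; first exact.
  by rewrite gdistC cab; apply: IHji; rewrite // (eq_sym j) (eq_sym b).
have cle := color_pattern_bounds i a.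
have c4a := @color_pattern4 i a; have c4b := @color_pattern4 j b.
rewrite /gdist; case: (ltngtP i j) le_ij nab => // [lt_ij _ _ | eq_ij _ /= nab].
  have [ji | nji] := eqVneq j i.+1.
    rewrite ji in cab *; have := color_pattern_next a4 b4 cab; lia.
  have [c4 | nc4] := eqVneq (color_pattern i a) 4; last by lia.
  rewrite c4 (c4a c4) c4b -?cab //.
  by rewrite /cdist; lia.
move: cab c4b; rewrite -eq_ij => cab c4b.
have := color_pattern_copy cab; case: eqP => [-> | c1] abm.
  by apply: cdist_ge_dvd => //; rewrite dvdn_mulr.
have le4 : 4 <= cdist (4 * s) a b by apply: cdist_ge_dvd; rewrite // dvdn_mulr.
have [c4 | nc4] := eqVneq (color_pattern i a) 4; last by lia.
by have a1 := c4a c4; move: c4; rewrite cab => /c4b b1; rewrite a1 b1 in nab.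
Qed.

Lemma copy_lt t (i : 'I_(3 * t %/ 3)) : i < t.
Proof. by case: i => i /=; rewrite mulKn. Qed.

Section AlignedProduct.

Variables (s t : nat).
Hypothesis (hs : 1 <= s).
Variable p : 'I_(3 * t %/ 3) -> path_in 3 (cycle_graph (4 * s)).
Let G := @path_aligned_product (3 * t) 3 _ p.
Implicit Types u v x y z : G.

Let n4 : 3 < 4 * s. Proof. lia. Qed.

Definition apos (x : G) : nat := cpos (p x.1) x.2.

Lemma aligned_adj_copy i (a b : cycle_graph (4 * s)) :
  adj a b -> adj ((i, a) : G) (i, b).
Proof. by move=> ab; apply/orP; left; apply/andP. Qed.

Lemma aligned_adj_bridge (i j : 'I_(3 * t %/ 3)) :
  j = i.+1 :> nat ->
  adj ((i, pathv (p i) 2) : G) (j, pathv (p j) 0).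
Proof.
move=> ji; rewrite /= /aligned_adj; apply/orP; right.
have ltj := copy_lt j.
have lta : i * 3 + 2 < 3 * t by lia.
have ltb : j * 3 < 3 * t by lia.
apply/existsP; exists (Ordinal lta); apply/existsP; exists (Ordinal ltb).
apply/and3P; split; first by rewrite /= /path_adj /=; lia.
  by apply/existsP; exists (inord 2); rewrite /= inordK // !eqxx.
by apply/existsP; exists (inord 0); rewrite /= inordK // addn0 !eqxx.
Qed.

Lemma aligned_adjP x y : adj x y ->
  [\/ x.1 = y.1 /\ adj x.2 y.2,
      [/\ y.1 = x.1.+1 :> nat, apos x = 2 & apos y = 0] |
      [/\ x.1 = y.1.+1 :> nat, apos x = 0 & apos y = 2]].
Proof.
case: x y => u a [v b]; case/orP=> [/andP[/eqP uv ab] | ]; first by constructor 1.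
case/existsP=> l /existsP[m /and3P[lm]].
case/existsP=> j /andP[/eqP /= lj /eqP /= aj].
case/existsP=> k /andP[/eqP /= mk /eqP /= bk].
have posa : apos (u, a) = j.
  by rewrite /apos /= aj -[j in p u j]inord_val cpos_pathv.
have posb : apos (v, b) = k.
  by rewrite /apos /= bk -[k in p v k]inord_val cpos_pathv.
rewrite posa posb; move: lm; rewrite /= /path_adj lj mk => lm.
have ltj := ltn_ord j; have ltk := ltn_ord k.
have [uv | nuv] := eqVneq u v.
  constructor 1; split=> //; rewrite aj bk -uv.
  apply: (path_vertex_adj (p u)); rewrite /= /path_adj.
  by move: lm; rewrite uv; clear; lia.
move: nuv ltj ltk lm; rewrite -val_eqE /=; clear.
have [lt_uv | le_vu] := ltnP u v => *; first by constructor 2; split; lia.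
by constructor 3; split; lia.
Qed.

Lemma apos_lt x : apos x < 4 * s.
Proof. exact: cpos_lt. Qed.

Definition adist (x y : G) := gdist (4 * s) x.1 (apos x) y.1 (apos y).

Lemma adist_adj z x y : adj x y -> adist z y <= (adist z x).+1.
Proof.
rewrite /adist; case/aligned_adjP=> [[xy1 xy2] | [-> -> ->] | [-> -> ->]].
- by rewrite xy1; apply: gdist_step; rewrite ?apos_lt // /apos xy1; apply: cpos_adj.
- by have [] := gdist_bridge z.1 (apos z) x.1 n4.
- by have [] := gdist_bridge z.1 (apos z) y.1 n4.
Qed.

Lemma adist_walk j x y : has_walk j x y -> adist x y <= j.
Proof.
case/existsP=> -[w /= /eqP <-] /andP[xw /eqP <-] {j y}.
elim/last_ind: w xw => [_ | w z IHw]; first by rewrite /adist /gdist eqxx cdistxx.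
rewrite rcons_path last_rcons size_rcons => /andP[/IHw xw wz].
by apply: leq_trans (adist_adj x wz) _.
Qed.

Lemma adist_color_pattern x y :
  x != y -> color_pattern x.1 (apos x) = color_pattern y.1 (apos y) ->
  color_pattern x.1 (apos x) < adist x y.
Proof.
move=> nxy; apply: gdist_color_pattern; rewrite ?apos_lt //.
rewrite -negb_and; apply: contra nxy => /andP[/eqP/val_inj xy1 /eqP xy2].
case: x y xy1 xy2 => i a [j b] /= ij; rewrite /apos /= ij.
by move/(cpos_inj n4)->.
Qed.

Lemma is_packing_color_pattern :
  is_packing (fun x : G => color_pattern x.1 (apos x)).
Proof.
move=> x y j nxy cxy jc; apply/negP => /adist_walk.
by have := adist_color_pattern nxy cxy; lia.
Qed.

Lemma aligned_packing_colorable4 : packing_colorable G 4.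
Proof.
apply/packing_colorableP.
exists (fun x : G => color_pattern x.1 (apos x)) => [x|];
  last exact: is_packing_color_pattern.
by rewrite color_pattern_bounds.
Qed.

Lemma aligned_packing_colorable3 : t = 1 -> packing_colorable G 3.
Proof.
move=> t1; apply/packing_colorableP.
exists (fun x : G => color_pattern x.1 (apos x)) => [x|];
  last exact: is_packing_color_pattern.
have -> : x.1 = 0 :> nat by have := copy_lt x.1; rewrite [X in _ < X]t1; lia.
by rewrite color_pattern0_bounds.
Qed.

Lemma aligned_not_packing_colorable2 : 0 < t -> ~ packing_colorable G 2.
Proof.
move=> t0; have i0 : 0 < 3 * t %/ 3 by rewrite mulKn.
pose i := Ordinal i0; have n3 : 2 < 4 * s by lia.
have [d cd db] := cycle_other_neighbor (pathv (p i) 2) (pathv (p i) 1) n3.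
have ab := adj_pathv (p i) (isT : 0 < 2).
have bc := adj_pathv (p i) (isT : 1 < 2).
apply: (@path4_not_packing_colorable2 G (i, pathv (p i) 0) (i, pathv (p i) 1)
  (i, pathv (p i) 2) (i, d)); try exact: aligned_adj_copy.
  by rewrite xpair_eqE eqxx pathv_neq.
by rewrite xpair_eqE eqxx eq_sym.
Qed.

Lemma aligned_not_packing_colorable3 : 1 < t -> ~ packing_colorable G 3.
Proof.
move=> t1; have i0 : 0 < 3 * t %/ 3 by rewrite mulKn; lia.
have j0 : 1 < 3 * t %/ 3 by rewrite mulKn.
pose i := Ordinal i0; pose j := Ordinal j0; have n3 : 2 < 4 * s by lia.
have [c' cc' c'b] := cycle_other_neighbor (pathv (p i) 2) (pathv (p i) 1) n3.
have [e' de' e'e] := cycle_other_neighbor (pathv (p j) 0) (pathv (p j) 1) n3.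
have ij : (i == j) = false by [].
have ji : (j == i) = false by [].
apply: (@two_claws_not_packing_colorable3 G
  (i, pathv (p i) 0) (i, pathv (p i) 1) (i, pathv (p i) 2) (i, c')
  (j, pathv (p j) 0) (j, e') (j, pathv (p j) 1) (j, pathv (p j) 2));
  try by apply: aligned_adj_copy => //; apply: adj_pathv.
- exact: aligned_adj_bridge.
- by rewrite /= !inE !xpair_eqE ij !eqxx /= !orbF !(negPf (pathv_neq _ _ _ _)).
- by rewrite xpair_eqE eqxx.
- by rewrite xpair_eqE ij.
- by rewrite xpair_eqE ji.
- by rewrite xpair_eqE eqxx.
Qed.

End AlignedProduct.

Theorem theorem2 (s t : nat) (hs : 1 <= s) (ht : 1 <= t)
  (p : 'I_(3 * t %/ 3) -> path_in 3 (cycle_graph (4 * s))) :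
  (t = 1 -> packing_chromatic_number (@path_aligned_product (3 * t) 3 _ p) = 3) /\
  (2 <= t -> packing_chromatic_number (@path_aligned_product (3 * t) 3 _ p) = 4).
Proof.
split=> t_val; apply: packing_chromatic_numberS.
- exact: aligned_packing_colorable3.
- exact: aligned_not_packing_colorable2.
- exact: aligned_packing_colorable4.
- exact: aligned_not_packing_colorable3.
Qed.
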